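(* Let $I\subseteq\mathbb{R}$ be an interval with $0\in I$, and let $\mathbf f=(f_1,\dots,f_n)$ be a system of real analytic functions on $I$ such that each $f_k$ equals the sum of its Maclaurin series on $I$. Suppose the infinite Wronskian $W_{\mathbf f}=(f_c^{(r-1)}(0))_{1\le r<\infty,\,1\le c\le n}$ is totally positive. Then $\mathbf f$ is totally positive on $I\cap(0,\infty)$, i.e. for every $x_1<\cdots<x_n$ in $I\cap(0,\infty)$ the collocation matrix $(f_c(x_r))_{r,c=1}^n$ is totally positive.
   Context: A (finite or infinite) matrix is totally positive (TP) if all its minors are nonnegative. *)

(* Defs.v *)
From HB Require Import structures.
From mathcomp Require Import all_boot all_order all_algebra.
From mathcomp Require Import all_classical all_reals all_analysis.
Set Implicit Arguments.
Unset Strict Implicit.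
Unset Printing Implicit Defensive.
Import Order.TTheory GRing.Theory Num.Theory.
Import numFieldNormedType.Exports.
Local Open Scope classical_set_scope.
Local Open Scope ring_scope.

(* Finite and infinite matrices are treated uniformly, as functions on totally
   ordered index sets; the minors are the determinants of the finite square
   submatrices given by increasing choices of rows and columns. *)
Definition totally_positive (R : realType) (d1 d2 : Order.disp_t)
    (I : orderType d1) (J : orderType d2) (A : I -> J -> R) : Prop :=
  forall (k : nat) (r : 'I_k -> I) (c : 'I_k -> J),
    {homo r : i j / (i < j)%O} -> {homo c : i j / (i < j)%O} ->
    0 <= \det (\matrix_(i < k, j < k) A (r i) (c j)).

(* Derivative relative to D, so one-sided at an endpoint of an interval D: only
   the values of f on D matter at points of D. *)
Definition derive_within (R : realType) (D : set R) (f : R -> R) (x : R) : R :=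
  lim ((f y - f x) / (y - x) @[y --> within D x^']).

Definition derive_within_n (R : realType) (D : set R) (k : nat) (f : R -> R) :
    R -> R :=
  iter k (derive_within D) f.

(* At an endpoint a of an interval D, convergence of the expansion on one side
   of a already makes the radius of convergence positive, so f extends
   analytically past a. *)
Definition real_analytic_on (R : realType) (D : set R) (f : R -> R) : Prop :=
  forall a, D a -> exists (u : R^nat) (e : R), 0 < e /\
    forall x, D x -> `|x - a| < e ->
      pseries u (x - a) @ \oo --> f x.

Definition eq_maclaurin_on (R : realType) (D : set R) (f : R -> R) : Prop :=
  forall x, D x ->
    pseries (fun k => derive_within_n D k f 0 / k`!%:R) x @ \oo --> f x.

(* Rows are numbered from 0: row k holds the derivatives of order k at 0. *)
Definition wronskian (R : realType) (n : nat) (D : set R)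
    (f : 'I_n -> R -> R) : nat -> 'I_n -> R :=
  fun k c => derive_within_n D k (f c) 0.

Definition collocation_mx (R : realType) (n : nat) (f : 'I_n -> R -> R)
    (x : 'I_n -> R) : 'M[R]_n :=
  \matrix_(r < n, c < n) f c (x r).

Definition totally_positive_on (R : realType) (n : nat) (D : set R)
    (f : 'I_n -> R -> R) : Prop :=
  forall x : 'I_n -> R, {homo x : i j / (i < j)%O} -> (forall r, D (x r)) ->
    totally_positive (collocation_mx f x).

(* Main.v *)
Require Import Defs.
From HB Require Import structures.
From mathcomp Require Import all_boot all_order all_algebra.
From mathcomp Require Import perm.
From mathcomp Require Import all_classical all_reals all_analysis.
Import Order.TTheory GRing.Theory Num.Theory.
Import numFieldNormedType.Exports.
Local Open Scope classical_set_scope.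
Local Open Scope ring_scope.

(* Truncating the Maclaurin series at order N factors the collocation matrix as
   (x_i ^ m)_(i, m < N) times the rows of the Wronskian divided by m!.  By the
   Cauchy-Binet formula, its minors are nonnegative as soon as generalized
   Vandermonde determinants at increasing positive nodes are, and this follows
   from Cauchy-Binet again, by induction on the number of nodes.  It remains to
   let N go to infinity. *)

Lemma sorting_perm (d : Order.disp_t) (T : orderType d) (k : nat)
    (g : 'I_k -> T) :
  injective g ->
  exists s : 'S_k, {homo (fun i => g (s i)) : i j / (i < j)%O}.
Proof.
move=> g_inj; set t := [tuple g i | i < k].
have /tuple_permP[s tE] : perm_eq (sort <=%O t) t by rewrite perm_sort.
(* Injectivity excludes ties, so sorting for [<=%O] yields a strict chain. *)
have srt : sorted <%O (sort <=%O t).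
  by rewrite sort_lt_sorted map_inj_uniq ?enum_uniq.
exists s => i j; rewrite ltEord => ij.
have gE (l : 'I_k) : g (s l) = nth (g i) (sort <=%O t) l.
  by rewrite tE -tnth_nth !tnth_mktuple.
by rewrite !gE lt_sorted_ltn_nth // inE size_sort size_tuple ltn_ord.
Qed.

Lemma det_scale_rows_cols (R : comPzRingType) (k : nat) (a b : 'I_k -> R)
    (M : 'I_k -> 'I_k -> R) :
  \det (\matrix_(i < k, j < k) (a i * M i j * b j)) =
  (\prod_i a i) * \det (\matrix_(i < k, j < k) M i j) * (\prod_j b j).
Proof.
rewrite /determinant mulr_sumr mulr_suml; apply: eq_bigr => s _.
under eq_bigr do rewrite mxE.
rewrite !big_split /= [\prod_j b j](reindex_perm s) /=.
have -> : \prod_i (\matrix_(i, j) M i j) i (s i) = \prod_i M i (s i).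
  by apply: eq_bigr => i _; rewrite mxE.
by rewrite !mulrA [_ * \prod_i a i]mulrC.
Qed.

(* The Cauchy-Binet sum over increasing families of indices, written as a sum
   over all families [g] so as to avoid choosing representatives. *)
Lemma det_mulmx_sum_ffun (R : comPzRingType) (k N : nat)
    (A : 'M[R]_(k, N)) (B : 'M[R]_(N, k)) :
  \det (A *m B) *+ k`! =
  \sum_(g : {ffun 'I_k -> 'I_N})
    \det (\matrix_(i, j) A i (g j)) * \det (\matrix_(i, j) B (g i) j).
Proof.
(* Precomposing [g] with a fixed [s] permutes the rows of the minor of [B], which produces the sign
   of [s]. Summing over all [s] then rebuilds the minor of [A] and accounts for the factor k!. *)
have expand (s : 'S_k) : \det (A *m B) = \sum_(g : {ffun 'I_k -> 'I_N})
    (-1) ^+ s * (\prod_i A i (g (s i))) * \det (\matrix_(i, j) B (g i) j).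
  (* Multilinearity: each row of [A *m B] is a combination of rows of [B]. *)
  have -> : \det (A *m B) = \sum_(g : {ffun 'I_k -> 'I_N})
      (\prod_i A i (g i)) * \det (\matrix_(i, j) B (g i) j).
    transitivity (\sum_(t : 'S_k) \sum_(g : {ffun 'I_k -> 'I_N})
        (-1) ^+ t * \prod_i (A i (g i) * B (g i) (t i))).
      apply: eq_bigr => t _; rewrite -mulr_sumr; congr (_ * _).
      rewrite -(bigA_distr_bigA (fun i l => A i l * B l (t i))) /=.
      by apply: eq_bigr => i _; rewrite mxE.
    rewrite exchange_big; apply: eq_bigr => g _ /=.
    rewrite mulr_sumr; apply: eq_bigr => t _.
    rewrite big_split /= mulrCA; congr (_ * (_ * _)).
    by apply: eq_bigr => i _; rewrite mxE.
  rewrite (reindex_onto (fun g : {ffun 'I_k -> 'I_N} => [ffun i => g (s i)])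
    (fun g : {ffun 'I_k -> 'I_N} => [ffun i => g ((s^-1)%g i)])) /=; last first.
    by move=> g _; apply/ffunP => i; rewrite !ffunE permK.
  apply: eq_big => [g|g _].
    by apply/eqP/ffunP => i; rewrite !ffunE permKV.
  have -> : \matrix_(i, j) B ([ffun l => g (s l)] i) j
      = perm_mx s *m (\matrix_(i, j) B (g i) j).
    rewrite -row_permE; apply/matrixP => i j; rewrite !mxE.
    by rewrite ffunE.
  rewrite det_mulmx det_perm.
  under eq_bigr do rewrite ffunE.
  by rewrite mulrCA mulrA.
have -> : \det (A *m B) *+ k`! = \sum_(s : 'S_k) \det (A *m B).
  by rewrite sumr_const card_Sn.
under eq_bigr => s _ do rewrite (expand s).
rewrite exchange_big; apply: eq_bigr => g _ /=.
rewrite -mulr_suml; congr (_ * _); apply: eq_bigr => s _.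
by congr (_ * _); apply: eq_bigr => i _; rewrite mxE.
Qed.

(** A non-injective family repeats a row of [B] and contributes zero. Any other is sorted by one
    permutation, whose sign enters both minors and so squares to 1. *)
Lemma det_mulmx_ge0 (R : realDomainType) (k N : nat)
    (A : 'M[R]_(k, N)) (B : 'M[R]_(N, k)) :
  (forall g : 'I_k -> 'I_N, {homo g : i j / (i < j)%O} ->
     0 <= \det (\matrix_(i, j) A i (g j))) ->
  (forall g : 'I_k -> 'I_N, {homo g : i j / (i < j)%O} ->
     0 <= \det (\matrix_(i, j) B (g i) j)) ->
  0 <= \det (A *m B).
Proof.
move=> A_ge0 B_ge0.
rewrite -(pmulrn_lge0 _ (fact_gt0 k)) det_mulmx_sum_ffun.
apply: sumr_ge0 => g _; have [g_inj|/injectivePn[i [j ij gij]]] :=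
  boolP (injectiveb g); last first.
  rewrite [X in _ * X](determinant_alternate ij) ?mulr0 // => l.
  by rewrite !mxE gij.
have [s s_homo] := sorting_perm _ _ _ _ (injectiveP _ g_inj).
have := mulr_ge0 (A_ge0 _ s_homo) (B_ge0 _ s_homo).
have -> : \matrix_(i, j) A i (g (s j)) =
    (\matrix_(i, j) A i (g j)) *m perm_mx (s^-1)%g.
  by rewrite -col_permE; apply/matrixP => i j; rewrite !mxE.
have -> : \matrix_(i, j) B (g (s i)) j =
    perm_mx s *m (\matrix_(i, j) B (g i) j).
  by rewrite -row_permE; apply/matrixP => i j; rewrite !mxE.
rewrite !det_mulmx !det_perm odd_permV -mulrA.
by rewrite [X in _ * X]mulrA -expr2 sqrr_sign mul1r.
Qed.

Lemma homo_lift0 (d : Order.disp_t) (T : orderType d) (k : nat)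
    (g : 'I_k.+1 -> T) :
  {homo g : i j / (i < j)%O} ->
  {homo (fun i => g (lift ord0 i)) : i j / (i < j)%O}.
Proof. by move=> g_homo i j ij; apply: g_homo. Qed.

Lemma homo_ord0_le (k : nat) (s : 'I_k.+1 -> nat) :
  {homo s : i j / (i < j)%O} -> forall j, (s ord0 <= s j)%N.
Proof.
move=> s_homo j; have [->//|j0] := eqVneq j ord0.
by apply/ltnW/(s_homo ord0 j); rewrite ltEord lt0n.
Qed.

(* Either the first column vanishes, or the first two rows are both constantly
   1, or the first column is that of the identity. *)
Lemma det_threshold_ge0 (R : realDomainType) (k : nat) (s m : 'I_k -> nat) :
  {homo s : i j / (i < j)%O} -> {homo m : i j / (i < j)%O} ->
  0 <= \det (\matrix_(i < k, j < k) (s i <= m j)%N%:R) :> R.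
Proof.
elim: k s m => [|k IHk] s m s_homo m_homo; first by rewrite det_mx00.
have m_min := homo_ord0_le _ _ m_homo.
have [s0m0|s0m0] := leqP (s ord0) (m ord0); last first.
  rewrite (expand_det_col _ ord0) big1 // => i _; rewrite mxE.
  by rewrite leqNgt (leq_trans s0m0) ?mul0r // homo_ord0_le.
have [i sim0|sm0] := pickP (fun i : 'I_k => s (lift ord0 i) <= m ord0)%N.
  rewrite (@determinant_alternate _ _ _ ord0 (lift ord0 i)) // => j.
  by rewrite !mxE !(leq_trans _ (m_min j)).
rewrite (expand_det_col _ ord0) big_ord_recl mxE s0m0 mul1r.
rewrite big1 ?addr0 => [|i _]; last by rewrite mxE sm0 mul0r.
rewrite /cofactor /= expr0 mul1r.
suff -> : row' ord0 (col' ord0 (\matrix_(i, j) (s i <= m j)%N%:R)) =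
    \matrix_(i, j) (s (lift ord0 i) <= m (lift ord0 j))%N%:R :> 'M[R]_k.
  by apply: IHk; apply: homo_lift0.
by apply/matrixP => i j; rewrite !mxE.
Qed.

(* The right factor is a Toeplitz matrix, and the top row of the left one is that
   of the identity; after expansion along it, what remains of the left factor is
   a generalized Vandermonde matrix of smaller size. *)
Lemma gen_vandermonde_factor (R : comPzRingType) (k N : nat)
    (x : 'I_k.+1 -> R) (m : 'I_k.+1 -> nat) :
  (forall j, (m j < N)%N) ->
  \matrix_(i < k.+1, j < k.+1) x i ^+ m j =
  (\matrix_(i < k.+1, s < N)
     (if s == 0 :> nat then 1 else (x i - x ord0) * x i ^+ s.-1)) *m
  (\matrix_(s < N, j < k.+1) (x ord0 ^+ (m j - s) *+ (s <= m j)%N)).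
Proof.
move=> mN; apply/matrixP => i j; rewrite !mxE.
under eq_bigr do rewrite !mxE.
case: N mN => [|N] mN; first by have := mN ord0.
have -> : \sum_(s < N.+1) (if s == 0 :> nat then 1
     else (x i - x ord0) * x i ^+ s.-1) *
     (x ord0 ^+ (m j - s) *+ (s <= m j)%N) =
  \sum_(s < (m j).+1) (if s == 0 :> nat then 1
     else (x i - x ord0) * x i ^+ s.-1) * x ord0 ^+ (m j - s).
  rewrite (big_ord_widen N.+1 (fun s : nat => (if s == 0 :> nat then 1
     else (x i - x ord0) * x i ^+ s.-1) * x ord0 ^+ (m j - s))) ?mN //.
  rewrite [RHS]big_mkcond; apply: eq_bigr => s _; rewrite ltnS.
  by case: leqP; rewrite ?mulr0.
(* The term of index 0 is [x ord0 ^+ m j]; the others add up to [x i ^+ m j - x ord0 ^+ m j], by the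
   factorization of a difference of powers. *)
rewrite big_ord_recl /= mul1r subn0; apply/eqP.
rewrite addrC -subr_eq; apply/eqP.
rewrite -opprB subrXX -mulNr opprB mulr_sumr; apply: eq_bigr => s _.
rewrite /= /bump add1n subnS -subn1 subnAC subn1 -mulrA; congr (_ * _).
by rewrite mulrC.
Qed.

Lemma det_gen_vandermonde_ge0 (R : realFieldType) (k : nat)
    (x : 'I_k -> R) (m : 'I_k -> nat) :
  (forall i, 0 < x i) -> {homo x : i j / (i < j)%O} ->
  {homo m : i j / (i < j)%O} ->
  0 <= \det (\matrix_(i < k, j < k) x i ^+ m j).
Proof.
elim: k x m => [|k IHk] x m x_gt0 x_homo m_homo; first by rewrite det_mx00.
have [N mN] : exists N, forall j, (m j < N)%N.
  by exists (\max_j m j).+1 => j; rewrite ltnS (leq_bigmax j).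
rewrite (gen_vandermonde_factor _ _ _ _ _ mN).
apply: det_mulmx_ge0 => g g_homo; last first.
  (* Up to positive diagonal factors, the Toeplitz matrix is a threshold one. *)
  set M := (X in \det X).
  have -> : M = \matrix_(i, j)
      ((x ord0 ^+ g i)^-1 * (g i <= m j)%N%:R * x ord0 ^+ m j).
    apply/matrixP => i j; rewrite !mxE; case: leqP => [gm|_]; last first.
      by rewrite mulr0 mul0r.
    by rewrite mulr1 mulrC expfB_cond // gt_eqF //= subn0.
  rewrite (det_scale_rows_cols _ _ _ _ (fun i j => (g i <= m j)%N%:R)).
  have pow_ge0 e : 0 <= x ord0 ^+ e by rewrite exprn_ge0 // ltW.
  rewrite !mulr_ge0 ?prodr_ge0 // => [i _|]; first by rewrite invr_ge0.
  exact: det_threshold_ge0.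
(* The top row of this minor is 1 where [g] is 0 and vanishes elsewhere, and [g] can be 0 only at
   the first column. If it is, the cofactor has positive row factors [x (lift ord0 i) - x ord0] and
   exponents lowered by 1, still increasing, so induction applies. *)
rewrite (expand_det_row _ ord0) big_ord_recl !mxE.
have g_gt0 (j : 'I_k) : (0 < g (lift ord0 j))%N.
  have : (g ord0 < g (lift ord0 j))%O by apply: g_homo.
  by rewrite ltEord; case: (nat_of_ord (g (lift _ _))).
rewrite big1 ?addr0 => [|j _]; last first.
  by rewrite !mxE gtn_eqF // subrr !mul0r.
have [_|_] := eqVneq (g ord0 : nat) 0; last by rewrite subrr !mul0r.
rewrite mul1r /cofactor expr0 mul1r; set M := (X in \det X).
have -> : M = \matrix_(i, j) ((x (lift ord0 i) - x ord0) *
    x (lift ord0 i) ^+ (g (lift ord0 j)).-1 * 1).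
  by apply/matrixP => i j; rewrite !mxE gtn_eqF ?mulr1.
rewrite (det_scale_rows_cols _ _ _ (fun _ => 1)
  (fun i j => x (lift ord0 i) ^+ (g (lift ord0 j)).-1)).
rewrite !mulr_ge0 ?prodr_ge0 // => [i _|].
  by rewrite subr_ge0 ltW // x_homo.
apply: IHk => // [|i j ij]; first exact: homo_lift0.
have := homo_lift0 _ _ _ _ g_homo i j ij.
rewrite ltEord ltEnat /= -!subn1 => gij.
by rewrite ltn_sub2r // (leq_ltn_trans (g_gt0 i)).
Qed.

(** The Leibniz formula is a polynomial in the entries. *)
Lemma cvg_det (R : realType) (T : Type) (F : set_system T) (FF : Filter F)
    (k : nat) (M : T -> 'M[R]_k) (L : 'M[R]_k) :
  (forall i j, M t i j @[t --> F] --> L i j) ->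
  \det (M t) @[t --> F] --> \det L.
Proof.
move=> ML; rewrite /determinant; apply: cvg_big => [|s _].
  exact: add_continuous.
apply: cvgM; first exact: cvg_cst.
by apply: cvg_big => [|i _]; [exact: mul_continuous|exact: ML].
Qed.

Theorem theorem2 (R : realType) (I : set R) (hI : is_interval I) (hI0 : I 0)
    (n : nat) (f : 'I_n -> R -> R)
    (hf : forall k, real_analytic_on I (f k))
    (hmac : forall k, eq_maclaurin_on I (f k))
    (hW : totally_positive (wronskian I f)) :
  totally_positive_on (I `&` [set x | 0 < x]) f.
Proof.
move=> x x_homo xI k r c r_homo c_homo.
have y_homo : {homo x \o r : i j / (i < j)%O}.
  by move=> i j ij; apply/x_homo/r_homo.
pose V N : 'M[R]_(k, N) := \matrix_(i, m) x (r i) ^+ m.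
pose W N : 'M[R]_(N, k) := \matrix_(m, j) (wronskian I f m (c j) / m`!%:R).
have VW_ge0 N : 0 <= \det (V N *m W N).
  (* The nodes [x (r i)] are positive and increasing, which settles the minors of [V N]; those of
     [W N] are Wronskian minors with rows divided by factorials. *)
  apply: det_mulmx_ge0 => g g_homo; set M := (X in \det X).
    have -> : M = \matrix_(i, j) (x \o r) i ^+ g j.
      by apply/matrixP => i j; rewrite !mxE.
    by apply: det_gen_vandermonde_ge0 => // i; have [] := xI (r i).
  have -> : M = \matrix_(i, j) ((g i)`!%:R^-1 * wronskian I f (g i) (c j) * 1).
    by apply/matrixP => i j; rewrite !mxE mulr1 mulrC.
  rewrite (det_scale_rows_cols _ _ _ (fun _ => 1)
    (fun i j => wronskian I f (g i) (c j))).
  rewrite !mulr_ge0 ?prodr_ge0 //.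
  exact: (hW k (fun i => g i : nat) c).
suff VW_cvg : \det (V N *m W N) @[N --> \oo] -->
    \det (\matrix_(i, j) collocation_mx f x (r i) (c j)).
  rewrite -(cvg_lim _ VW_cvg) //.
  by apply: limr_ge; [exact: cvgP VW_cvg | exact: nearW].
apply: cvg_det => i j; rewrite !mxE.
have [Ix _] := xI (r i).
(* Each entry of the product is a partial sum of the Maclaurin series of [f (c j)] at [x (r i)]. *)
suff -> : (fun N => (V N *m W N) i j) =
    pseries (fun m => wronskian I f m (c j) / m`!%:R) (x (r i)).
  exact: hmac.
apply/funext => N; rewrite mxE /pseries /series /= big_mkord.
by apply: eq_bigr => m _; rewrite !mxE mulrC.
Qed.
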